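(* Let $T\subset\{0,1\}^{\mathbb Z}$ be the Toeplitz minimal set. A bilaterally infinite sequence $x\in\{0,1\}^{\mathbb Z}$ belongs to $T$ if and only if $x$ contains no block of the form $BB$, where $B$ is a nonempty block in which the number of zeros is even.
   Context: A block is a finite word; a block $w=w_1\dots w_n$ is contained in (appears in) $x=(x_i)_{i\in\mathbb Z}$ if $x_{j+1}\dots x_{j+n}=w$ for some $j\in\mathbb Z$. $BB$ denotes the concatenation of $B$ with itself; zero is an even number. $\sigma$ denotes the left shift, $[\sigma(x)]_i=x_{i+1}$. The Toeplitz substitution is $\tau(0)=01$, $\tau(1)=00$. It determines a map $\overline\tau:\{0,1\}^{\mathbb Z}\to\{0,1\}^{\mathbb Z}$ by $[\overline\tau(x)]_{2n}[\overline\tau(x)]_{2n+1}=\tau(x_n)$ for all $n\in\mathbb Z$. The map $\overline\tau$ has exactly two periodic points, $t_{0.0}$ and $t_{1.0}$, where $t_{a.0}$ is the unique point $x$ fixed by $\overline\tau^{\,2}$ with $x_{-1}=a$ and $x_0=0$; they have the same shift orbit closure. The Toeplitz minimal set is $T=\mathrm{cl}\{\sigma^n(t_{0.0}):n\in\mathbb Z\}=\mathrm{cl}\{\sigma^n(t_{1.0}):n\in\mathbb Z\}$, the closure being taken in the product topology on $\{0,1\}^{\mathbb Z}$. *)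

(* Defs.v *)
From mathcomp Require Import all_boot all_order all_algebra.
From mathcomp Require Import all_classical topology.
From mathcomp Require Import zify.

Set Implicit Arguments.
Unset Strict Implicit.
Unset Printing Implicit Defensive.

Import Order.TTheory GRing.Theory Num.Theory.
Local Open Scope classical_set_scope.
Local Open Scope ring_scope.

(* The letters 0 and 1 are the (discrete) booleans false and true; the type
   below carries the product topology. *)
Notation biseq := {ptws int -> bool}.

Definition shift (x : biseq) : biseq := fun i => x (i + 1).

Definition shiftz (n : int) (x : biseq) : biseq := fun i => x (i + n).

(* shiftz n is the n-th power of shift for all n in Z: the three lemmas below
   characterise it. *)
Lemma shiftz0 (x : biseq) : shiftz 0 x = x.
Proof. by apply/funext => i; rewrite /shiftz addr0. Qed.

Lemma shiftzS (n : int) (x : biseq) : shiftz (n + 1) x = shift (shiftz n x).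
Proof. by apply/funext => i; rewrite /shiftz /shift addrAC addrA. Qed.

Lemma shift_shiftzB1 (n : int) (x : biseq) :
  shift (shiftz (n - 1) x) = shiftz n x.
Proof. by rewrite -shiftzS subrK. Qed.

Definition shift_orbit (x : biseq) : set biseq := [set shiftz n x | n in [set: int]].

Definition tau (a : bool) : seq bool :=
  if a then [:: false; false] else [:: false; true].

Definition taubar (x : biseq) : biseq :=
  fun i => nth false (tau (x (i %/ 2)%Z)) `|(i %% 2)%Z|%N.

Lemma taubarE (x : biseq) (n : int) :
  [:: taubar x (2 * n); taubar x (2 * n + 1)] = tau (x n).
Proof.
rewrite /taubar.
have -> : ((2 * n) %/ 2)%Z = n by lia.
have -> : ((2 * n) %% 2)%Z = 0 by lia.
have -> : ((2 * n + 1) %/ 2)%Z = n by lia.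
have -> : ((2 * n + 1) %% 2)%Z = 1 by lia.
by rewrite /tau; case: (x n).
Qed.

Lemma taubar_unique (x y : biseq) :
  (forall n, [:: y (2 * n); y (2 * n + 1)] = tau (x n)) -> y = taubar x.
Proof.
move=> yE; apply/funext => i.
have [n [->|->]] : exists n : int, i = 2 * n \/ i = 2 * n + 1.
  by exists (i %/ 2)%Z; lia.
- by have := yE n; rewrite -taubarE => -[].
- by have := yE n; rewrite -taubarE => -[].
Qed.

Definition is_toeplitz_point (a : bool) (x : biseq) : Prop :=
  [/\ taubar (taubar x) = x, x (-1) = a & x 0 = false].

Definition toeplitz_point (a : bool) : biseq :=
  [get x : int -> bool | is_toeplitz_point a x].

Lemma taubar2E (x : biseq) (i : int) : taubar (taubar x) i =
  if (i %% 2)%Z == 0 then false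
  else if (i %% 4)%Z == 1 then true else x (i %/ 4)%Z.
Proof.
have [n [->|->]] : exists n : int, i = 2 * n \/ i = 2 * n + 1.
  by exists (i %/ 2)%Z; lia.
  have [-> _] : [:: taubar (taubar x) (2 * n); taubar (taubar x) (2 * n + 1)] =
     [:: false; ~~ taubar x n] by rewrite taubarE; case: (taubar x n).
  by have -> : (((2 * n) %% 2)%Z == 0) by lia.
have [_ ->] : [:: taubar (taubar x) (2 * n); taubar (taubar x) (2 * n + 1)] =
   [:: false; ~~ taubar x n] by rewrite taubarE; case: (taubar x n).
have -> : (((2 * n + 1) %% 2)%Z == 0) = false by lia.
have [m [->|->]] : exists m : int, n = 2 * m \/ n = 2 * m + 1.
  by exists (n %/ 2)%Z; lia.
  have [-> _] : [:: taubar x (2 * m); taubar x (2 * m + 1)] =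
     [:: false; ~~ x m] by rewrite taubarE; case: (x m).
  by have -> : (((2 * (2 * m) + 1) %% 4)%Z == 1) by lia.
have [_ ->] : [:: taubar x (2 * m); taubar x (2 * m + 1)] =
   [:: false; ~~ x m] by rewrite taubarE; case: (x m).
have -> : (((2 * (2 * m + 1) + 1) %% 4)%Z == 1) = false by lia.
have -> : ((2 * (2 * m + 1) + 1) %/ 4)%Z = m by lia.
by rewrite negbK.
Qed.

Lemma is_toeplitz_point_unique (a : bool) (x y : biseq) :
  is_toeplitz_point a x -> is_toeplitz_point a y -> x = y.
Proof.
move=> [fx x1 x0] [fy y1 y0]; apply/funext => i.
have [n] := ubnP (absz (i + 1)); elim: n i => // n IHn i ltin.
have [->|i1] := eqVneq i (-1); first by rewrite x1.
rewrite -fx -fy !taubar2E.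
case: eqP => // i2; case: eqP => // i4.
by apply: IHn; lia.
Qed.

Lemma toeplitz_pointP (a : bool) : is_toeplitz_point a (toeplitz_point a).
Proof.
rewrite /toeplitz_point; apply: (@getPex (int -> bool)).
(* ruler sequence: the value at i is the parity of the 2-adic valuation of
   i + 1, which is undefined at -1 *)
pose t : biseq := fun i => if i == -1 then a else odd (logn 2 (absz (i + 1))).
exists t; split; rewrite /t //=; last first.
apply/funext => i; rewrite taubar2E /t.
have lognM k m : (0 < m)%N -> (logn 2 (2 ^ k * m) = k + logn 2 m)%N.
  by move=> m0; rewrite lognM ?expn_gt0// pfactorK.
have odd0 m : odd m -> logn 2 m = 0%N.
  by move=> om; apply: logn_coprime; rewrite coprime2n.
case: eqP => i2.
  have -> : (i == -1) = false by lia.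
  by rewrite odd0; lia.
case: eqP => i4.
  have -> : (i == -1) = false by lia.
  have -> : (absz (i + 1)%R = 2 ^ 1 * absz ((i %/ 2)%Z + 1)%R)%N by lia.
  by rewrite lognM ?odd0 //; lia.
have [->|i1] := eqVneq i (-1); first by have -> : ((-1) %/ 4)%Z = -1 :> int by lia.
have -> : ((i %/ 4)%Z == -1) = false by lia.
have -> : (absz (i + 1)%R = 2 ^ 2 * absz ((i %/ 4)%Z + 1)%R)%N by lia.
by rewrite lognM //; lia.
Qed.

Definition toeplitz_set : set biseq := closure (shift_orbit (toeplitz_point false)).

Definition contains (x : biseq) (w : seq bool) : Prop :=
  exists j : int, mkseq (fun k => x (j + k.+1%:Z)) (size w) = w.

(* Main.v *)
Require Import Defs.
From mathcomp Require Import all_boot all_order all_algebra.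
From mathcomp Require Import all_classical topology.
From mathcomp Require Import zify.

Set Implicit Arguments.
Unset Strict Implicit.
Unset Printing Implicit Defensive.

Import GRing.Theory.
Local Open Scope ring_scope.

(** Call a square BB even when B is nonempty and has an even number of zeros.
In taubar y all letters at even positions are 0 and the others are the
complemented letters of y.  This ties the even squares of y to those of
taubar y: a square of even length 2n can be rotated into one starting at an
even position, which is the image of a square of y with the same parity of
zeros, whereas a square of odd length compares every letter with one at an
even position, so that B is an odd number of zeros.

From left to right, halving the length over and over shows that a point fixed
by taubar^2 has no even square ([avoids_taubar2_fixed]), and having none is a
property of finite blocks, hence closed and shift invariant.

From right to left, the squares of 1, 00 and 010 alone force one of the two
classes of positions modulo 2 to carry only zeros ([avoids_even_zeros]).  So,
up to a shift, x is the image under taubar of a sequence which again has no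
even square ([avoids_desubstitute]), and this can be iterated: x is a shift of
taubar^(2k) y.  A block of x shorter than 2^(2k) lies in the image of a pair
of adjacent letters of y; that pair is not 11, hence it occurs in the Toeplitz
point t, and its image occurs in taubar^(2k) t = t
([avoids_factor_toeplitz]). *)

(** * Sequences without even squares *)

Definition window (x : biseq) (j : int) (n : nat) : seq bool :=
  mkseq (fun k => x (j + k%:Z)) n.

Definition has_period_on (x : biseq) (j : int) (n : nat) : Prop :=
  forall k, (k < n)%N -> x (j + k%:Z) = x (j + (n + k)%:Z).

(** The length of the root is fixed because squares of y of length n are
compared with squares of taubar y of length 2n. *)
Definition odd_squares (n : nat) (x : biseq) : Prop :=
  forall j, has_period_on x j n -> odd (count_mem false (window x j n)).

Definition avoids (x : biseq) : Prop := forall n, (0 < n)%N -> odd_squares n x.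

Lemma size_window x j n : size (window x j n) = n.
Proof. exact: size_mkseq. Qed.

Lemma nth_window x j n k : (k < n)%N -> nth false (window x j n) k = x (j + k%:Z).
Proof. by move=> kn; rewrite nth_mkseq. Qed.

Lemma avoidsP x : avoids x <->
  ~ (exists B : seq bool,
       [/\ B <> [::], ~~ odd (count_mem false B) & contains x (B ++ B)]).
Proof.
split=> [xav [B [/eqP B0 evB [j]]]|xav n n0 j per].
  set n := size B; move=> jB.
  have xB k : (k < n + n)%N -> x (j + 1 + k%:Z) = nth false (B ++ B) k.
    move=> kn; have := congr1 (fun s => nth false s k) jB.
    by rewrite nth_mkseq ?size_cat// => <-; congr (x _); lia.
  have BE : B = window x (j + 1) n.
    apply: (@eq_from_nth _ false) => [|k kn]; first by rewrite size_window.
    by rewrite nth_window// xB ?ltn_addr// nth_cat kn.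
  move: evB; rewrite BE => /negP; apply; apply: xav => [|k kn].
    by rewrite lt0n size_eq0.
  by rewrite !xB ?ltn_add2l ?ltn_addr// !nth_cat kn ltnNge leq_addr/= addKn.
apply/negP => /negP ev; apply: xav; exists (window x j n); split=> //.
  by move/(congr1 size); rewrite size_window; move: n0 => /[swap] ->.
exists (j - 1); apply: (@eq_from_nth _ false) => [|k].
  by rewrite size_mkseq.
rewrite size_mkseq size_cat size_window => kn.
rewrite nth_mkseq ?size_cat ?size_window//.
rewrite nth_cat size_window; case: ltnP => kn'.
  by rewrite nth_window//; congr (x _); lia.
have kn2 : (k - n < n)%N by lia.
by rewrite nth_window// (per _ kn2); congr (x _); lia.
Qed.

Lemma windowSl x j n : window x j n.+1 = x j :: window x (j + 1) n.
Proof.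
apply: (@eq_from_nth _ false) => [|k]; first by rewrite [RHS]/= !size_window.
rewrite size_window => kn; rewrite nth_window//.
case: k kn => [|k] kn /=; first by rewrite addr0.
by rewrite nth_window//; congr (x _); lia.
Qed.

Lemma windowSr x j n : window x j n.+1 = rcons (window x j n) (x (j + n%:Z)).
Proof.
apply: (@eq_from_nth _ false) => [|k]; first by rewrite size_rcons !size_window.
rewrite size_window => kn; rewrite nth_window// nth_rcons size_window.
case: ltngtP => kn'; [by rewrite nth_window//|lia|by rewrite kn'].
Qed.

(** * Squares and the substitution *)

Lemma taubar_even y i : taubar y (2 * i) = false.
Proof. by have := taubarE y i; case: (y i) => -[]. Qed.

Lemma taubar_odd y i : taubar y (2 * i + 1) = ~~ y i.
Proof. by have := taubarE y i; case: (y i) => -[]. Qed.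

(** tau 0 has one zero and tau 1 has two, so modulo 2 only the zeros of y
contribute. *)
Lemma odd_zeros_taubar y j n :
  odd (count_mem false (window (taubar y) (2 * j) (n * 2))) =
  odd (count_mem false (window y j n)).
Proof.
elim: n => [//|n IHn].
rewrite mulSn add2n !windowSr -!cats1 !count_cat !oddD IHn -addbA /=.
have -> : 2 * j + (n * 2)%:Z = 2 * (j + n%:Z) by lia.
have -> : 2 * j + (n * 2).+1%:Z = 2 * (j + n%:Z) + 1 by lia.
by rewrite taubar_even taubar_odd; case: (y _).
Qed.

Lemma odd_squares_taubar_inv n y :
  odd_squares (n * 2) (taubar y) -> odd_squares n y.
Proof.
move=> sq j per; rewrite -odd_zeros_taubar; apply: sq => k kn.
have [m [kE|kE]] : exists m : nat, k = (2 * m)%N \/ k = (2 * m + 1)%N.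
- by exists (k %/ 2)%N; lia.
- have -> : 2 * j + k%:Z = 2 * (j + m%:Z) by lia.
  have -> : 2 * j + (n * 2 + k)%:Z = 2 * (j + (n + m)%:Z) by lia.
  by rewrite !taubar_even.
- have -> : 2 * j + k%:Z = 2 * (j + m%:Z) + 1 by lia.
  have -> : 2 * j + (n * 2 + k)%:Z = 2 * (j + (n + m)%:Z) + 1 by lia.
  by rewrite !taubar_odd per//; lia.
Qed.

(** A square starting at an odd position is preceded by a 0 and its root ends
with a 0, both at even positions; shifting it one step to the left gives an
aligned square whose root is a rotation of the original one. *)
Lemma odd_squares_taubar n y :
  odd_squares n y -> odd_squares (n * 2) (taubar y).
Proof.
move=> sq.
have aligned j : has_period_on (taubar y) (2 * j) (n * 2) ->
    odd (count_mem false (window (taubar y) (2 * j) (n * 2))).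
  move=> per; rewrite odd_zeros_taubar; apply: sq => k kn.
  apply: negb_inj; rewrite -!taubar_odd.
  have kn2 : (2 * k + 1 < n * 2)%N by lia.
  have := per _ kn2.
  by congr (taubar y _ = taubar y _); lia.
move=> i; have [j [->|->] per] : exists j : int, i = 2 * j \/ i = 2 * j + 1.
- by exists (i %/ 2)%Z; lia.
- exact: aligned.
(* the last position of the first copy of the root is even *)
have endE : 2 * j + (n * 2)%:Z = 2 * (j + n%:Z) by lia.
have /aligned : has_period_on (taubar y) (2 * j) (n * 2).
  case=> [|k] kn.
    have -> : 2 * j + (n * 2 + 0)%:Z = 2 * (j + n%:Z) by lia.
    by rewrite addr0 !taubar_even.
  have := per k (ltnW kn).
  by congr (taubar y _ = taubar y _); lia.
have := congr1 (count_mem false) (windowSl (taubar y) (2 * j) (n * 2)).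
rewrite windowSr -cats1 count_cat endE /= !taubar_even addn0 addnC.
by move=> /addnI ->.
Qed.

(** Of two positions at an odd distance n one is even and carries a 0, so all
letters of the root are 0, and there are n of them. *)
Lemma odd_squares_taubar_odd n y : odd n -> odd_squares n (taubar y).
Proof.
move=> on j per; suff -> : window (taubar y) j n = nseq n false.
  by rewrite count_nseq mul1n.
apply: (@eq_from_nth _ false) => [|k]; first by rewrite size_window size_nseq.
rewrite size_window => kn; rewrite nth_window// nth_nseq kn.
have [m [jk|jk]] : exists m : int, j + k%:Z = 2 * m \/ j + k%:Z = 2 * m + 1.
- by exists ((j + k%:Z) %/ 2)%Z; lia.
- by rewrite jk taubar_even.
- rewrite per//; have -> : j + (n + k)%:Z = 2 * (m + (n./2).+1%:Z) by lia.
  exact: taubar_even.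
Qed.

(** Descent on the length n: odd n is impossible for an even square, and an
even n reduces a square of t to one of taubar t, or of taubar t to one of t,
of half the length. *)
Lemma avoids_taubar2_fixed t : taubar (taubar t) = t -> avoids t.
Proof.
move=> fixt n; suff H : (0 < n)%N -> odd_squares n t /\ odd_squares n (taubar t).
  by move=> /H[].
elim/ltn_ind: n => n IHn n0.
have [on|en] := boolP (odd n).
  by rewrite -{1}fixt; split; apply: odd_squares_taubar_odd.
have [sqt sqt'] := IHn n./2 ltac:(lia) ltac:(lia).
have nE : n = (n./2 * 2)%N by lia.
by rewrite nE -{1}fixt; split; apply: odd_squares_taubar.
Qed.

Lemma avoids_agree x : (forall N : nat, exists2 y, avoids y &
  forall i : int, (absz i <= N)%N -> y i = x i) -> avoids x.
Proof.
move=> xy n n0 j per; have [y yav yx] := xy (absz j + n + n)%N.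
have -> : window x j n = window y j n.
  by apply/eq_in_map => k; rewrite mem_iota => kn; rewrite yx//; lia.
apply: yav => // k kn; have := per k kn.
by rewrite -!yx; lia.
Qed.

Lemma avoids_shiftz m x : avoids x -> avoids (shiftz m x).
Proof.
move=> xav n n0 j per; have -> : window (shiftz m x) j n = window x (j + m) n.
  by apply: eq_map => k; rewrite /shiftz addrAC.
apply: xav => // k kn; have := per k kn.
by rewrite /shiftz !(addrAC j m).
Qed.

Lemma avoids_taubar_inv y : avoids (taubar y) -> avoids y.
Proof.
by move=> yav n n0; apply: odd_squares_taubar_inv; apply: yav; lia.
Qed.

(** * Desubstitution *)

Lemma avoids_square x B i : avoids x -> B != [::] ->
  ~~ odd (count_mem false B) -> window x i (size (B ++ B)) <> B ++ B.
Proof.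
move=> /avoidsP xav /eqP B0 evB iB; apply: xav; exists B; split=> //.
exists (i - 1); rewrite -[RHS]iB; apply: eq_map => k.
by congr (x _); lia.
Qed.

Lemma avoids_no11 x i : avoids x -> x i -> ~~ x (i + 1).
Proof.
move=> /(@avoids_square _ [:: true] i) /(_ isT isT) sq xi; apply/negP => xi1.
by apply: sq; rewrite /= !windowSl xi xi1.
Qed.

Lemma avoids_no0000 x i : avoids x -> [|| x i, x (i + 1), x (i + 2) | x (i + 3)].
Proof.
move=> /(@avoids_square _ [:: false; false] i) /(_ isT isT) sq.
apply/negPn/negP; rewrite !negb_or => /and4P[/negbTE x0 /negbTE x1 /negbTE x2 /negbTE x3].
by apply: sq; rewrite /= !windowSl -!addrA x0 x1 x2 x3.
Qed.

(** Since 11 is excluded, 1001 extends to 010010, the square of 010. *)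
Lemma avoids_no1001 x i : avoids x -> x i -> ~~ x (i + 3).
Proof.
move=> xav xi; apply/negP => xi3.
have /negbTE xi1 := avoids_no11 xav xi.
have xi4 : x (i + 4) = false by rewrite -(negbTE (avoids_no11 xav xi3)) -addrA.
have xi2 : x (i + 2) = false.
  by apply/negP => /(avoids_no11 xav); rewrite -addrA xi3.
have xp : x (i - 1) = false.
  by apply/negP => /(avoids_no11 xav); rewrite subrK xi.
apply: (@avoids_square x [:: false; true; false] (i - 1)) => //.
by rewrite /= !windowSl subrK -!addrA xp xi xi1 xi2 xi3 xi4.
Qed.

(** Two zeros at distance 2 propagate in steps of 2 in both directions.  If
positions i and i + 2 carry 0, then i + 1 or i + 3 carries 1, as 0000 does not
occur; this 1 is at distance 1 or 3 from i + 4, which then carries 0. *)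
Lemma avoids_even_zeros x : avoids x ->
  exists e : int, forall n : int, x (e + 2 * n) = false.
Proof.
move=> xav.
have no11 i : x i -> x (i + 1) = false by move=> /(avoids_no11 xav)/negbTE.
have no1001 i : x i -> x (i + 3) = false by move=> /(avoids_no1001 xav)/negbTE.
pose S i := (x i == false) && (x (i + 2) == false).
have [e Se] : exists e, S e.
  have [x0|/negbTE x0] := boolP (x 0).
    by exists 1; rewrite /S (no11 _ x0) (no1001 _ x0).
  have [x2|/negbTE x2] := boolP (x 2).
    exists 1; rewrite /S (no11 _ x2) andbT.
    by apply/eqP/negP => /no11; rewrite x2.
  by exists 0; rewrite /S x0 x2.
have Sup i : S i -> S (i + 2).
  move=> /andP[/eqP x0 /eqP x2]; rewrite /S x2 /= -addrA; apply/eqP.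
  have := avoids_no0000 i xav; rewrite x0 x2 /=.
  by move=> /orP[/no1001|/no11]; rewrite -addrA.
have Sdown i : S i -> S (i - 2).
  move=> /andP[/eqP x0 /eqP x2]; rewrite /S subrK x0 eqxx andbT.
  apply/eqP/negP => xm.
  have := no1001 _ xm; rewrite (_ : i - 2 + 3 = i + 1); last by lia.
  have := no11 _ xm; rewrite (_ : i - 2 + 1 = i - 1); last by lia.
  have := avoids_no0000 (i - 1) xav.
  have -> : i - 1 + 2 = i + 1 by lia.
  have -> : i - 1 + 3 = i + 2 by lia.
  by rewrite subrK x0 x2 /= orbF => /orP[] ->.
have Sn n : S (e + 2 * n).
  elim: n => [|n IHn|n IHn]; first by rewrite mulr0 addr0.
    have -> : e + 2 * n.+1%:Z = e + 2 * n%:Z + 2 by lia.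
    exact: Sup IHn.
  have -> : e + 2 * - n.+1%:Z = e + 2 * - n%:Z - 2 by lia.
  exact: Sdown IHn.
by exists e => n; have /andP[/eqP] := Sn n.
Qed.

Lemma avoids_desubstitute x : avoids x ->
  exists (e : int) (y : biseq), avoids y /\ x = shiftz e (taubar y).
Proof.
move=> xav; have [e xe] := avoids_even_zeros xav.
pose y : biseq := fun n => ~~ x (e + (2 * n + 1)).
have yE : shiftz e x = taubar y.
  apply: taubar_unique => n.
  rewrite /shiftz addrC xe addrC /y /tau.
  by case: (x _).
exists (- e), y; split.
  by apply: avoids_taubar_inv; rewrite -yE; apply: avoids_shiftz.
by apply/funext => i; rewrite -yE /shiftz subrK.
Qed.

Lemma taubar_shiftz e y : taubar (shiftz e y) = shiftz (2 * e) (taubar y).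
Proof.
apply/esym/taubar_unique => n; rewrite /shiftz -taubarE.
by congr [:: taubar y _; taubar y _]; lia.
Qed.

Lemma shiftzD m n x : shiftz m (shiftz n x) = shiftz (m + n) x.
Proof. by apply/funext => i; rewrite /shiftz addrA. Qed.

Lemma avoids_desubstitute_iter k x : avoids x ->
  exists (m : int) (y : biseq), avoids y /\ x = shiftz m (iter k taubar y).
Proof.
elim: k x => [|k IHk] x xav.
  by exists 0, x; rewrite /= shiftz0.
have [e [y [yav ->]]] := avoids_desubstitute xav.
have [m [z [zav ->]]] := IHk _ yav.
by exists (e + 2 * m), z; rewrite taubar_shiftz shiftzD.
Qed.

(** * Blocks of the Toeplitz point *)

(** Each letter of taubar y depends on a single letter of y, so L letters of y
determine 2L letters of its image. *)
Lemma iter_taubar_local k y z a b L :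
    (forall r, (r < L)%N -> y (a + r%:Z) = z (b + r%:Z)) ->
  forall r, (r < 2 ^ k * L)%N ->
    iter k taubar y ((2 ^ k)%N%:Z * a + r%:Z) =
    iter k taubar z ((2 ^ k)%N%:Z * b + r%:Z).
Proof.
move=> yz; elim: k => [|k IHk] r; first by rewrite !mul1r mul1n => /yz.
rewrite expnS -mulnA => rk.
have {}IHk := IHk (r %/ 2)%N ltac:(lia).
set P := (2 ^ k)%N in IHk rk *.
have [m [rE|rE]] : exists m : nat, r = (2 * m)%N \/ r = (2 * m + 1)%N.
- by exists (r %/ 2)%N; lia.
- have mul2 c : (2 * P)%N%:Z * c + r%:Z = 2 * (P%:Z * c + m%:Z) by lia.
  by rewrite !mul2 /= !taubar_even.
- have mul2 c : (2 * P)%N%:Z * c + r%:Z = 2 * (P%:Z * c + m%:Z) + 1 by lia.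
  have rm : (r %/ 2 = m)%N by lia.
  by rewrite !mul2 /= !taubar_odd -rm IHk.
Qed.

(** The letters of t at positions -1, 0, 1, 2 are 0, 0, 1, 0. *)
Lemma toeplitz_pairs t p q : is_toeplitz_point false t -> ~~ (p && q) ->
  exists b : int, t b = p /\ t (b + 1) = q.
Proof.
move=> [fixt tm1 t0].
have t1 : t 1 = true by rewrite -fixt taubar2E.
have t2 : t 2 = false by rewrite -fixt taubar2E.
case: p; case: q => // _; [by exists 1|by exists 0|by exists (-1)].
Qed.

Lemma avoids_factor_toeplitz x t N : avoids x -> is_toeplitz_point false t ->
  exists m : int, forall i : int, (absz i <= N)%N -> shiftz m t i = x i.
Proof.
move=> xav tP; have [fixt _ _] := tP.
pose P := (2 ^ (2 * N.+1))%N.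
have NP : (2 * N < P)%N by rewrite (ltn_trans _ (ltn_expl _ _))//; lia.
have iter_fix k : iter (2 * k) taubar t = t.
  by elim: k => // k IHk; rewrite mulnS add2n !iterS IHk.
have [m [y [yav xE]]] := avoids_desubstitute_iter (2 * N.+1) xav.
(* [m - N, m + N] lies in the image of the pair of letters of y at a, a + 1 *)
pose a := ((m - N%:Z) %/ P%:Z)%Z.
have aE : 0 <= m - N%:Z - P%:Z * a < P%:Z by rewrite /a; lia.
have [b [tb tb1]] := @toeplitz_pairs t (y a) (y (a + 1)) tP ltac:(
  apply/negP => /andP[/(avoids_no11 yav)/negP]; exact).
have loc := @iter_taubar_local (2 * N.+1) y t a b 2.
exists (m + P%:Z * (b - a)) => i iN; rewrite xE /shiftz.
pose r := absz (i + m - P%:Z * a)%R.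
have yt s : (s < 2)%N -> y (a + s%:Z) = t (b + s%:Z).
  by case: s => [|[|//]] _; rewrite ?addr0 -?tb -?tb1.
have := loc yt r ltac:(rewrite -/P /r; lia).
rewrite iter_fix -/P.
have -> : P%:Z * a + r%:Z = i + m by rewrite /r; lia.
have -> : P%:Z * b + r%:Z = i + (m + P%:Z * (b - a)) by rewrite /r; lia.
by [].
Qed.

Local Open Scope classical_set_scope.

(** * Closure in the product topology *)

Lemma closure_ptwsP (A : set biseq) (x : biseq) : closure A x <->
  forall N : nat, exists2 y, A y & forall i : int, (absz i <= N)%N -> y i = x i.
Proof.
have nbhs1 (i : int) : nbhs x [set y : biseq | y i = x i].
  have := @proj_continuous int (fun=> bool) i x [set x i].
  by apply; apply: discrete_set1.
split=> [xA N|xA].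
  have : nbhs x [set y : biseq | forall i : int, (absz i <= N)%N -> y i = x i].
    elim: N => [|N IHN].
      apply: filterS (nbhs1 0) => y /= y0 i i0.
      by have -> : i = 0 by lia.
    apply: filterS3 (nbhs1 N.+1%:Z) (nbhs1 (- N.+1%:Z)) IHN.
    move=> y /= yp ym yN i iN.
    have [->//|[->//|/yN//]] : i = N.+1%:Z \/ i = - N.+1%:Z \/ (absz i <= N)%N by lia.
  by move=> /xA[y [Ay yx]]; exists y.
have [u uP] := choice (fun N => let: ex_intro2 y Ay yx := xA N in
  ex_intro (fun y => A y /\ forall i : int, (absz i <= N)%N -> y i = x i) y (conj Ay yx)).
have ux : {ptws, u @ \oo --> (x : int -> bool)}.
  apply/cvg_sup => i U [V] [[W] oW <-] Wxi WU.
  exists (absz i) => // N /= iN; apply: WU.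
  by rewrite /= /proj (uP N).2.
apply: (closed_cvg (closure A)) ux; first exact: closed_closure.
by apply: nearW => N; apply: subset_closure; apply: (uP N).1.
Qed.

Theorem mainTheorem1 (x : biseq) :
  toeplitz_set x <->
  ~ (exists B : seq bool,
       [/\ B <> [::], ~~ odd (count_mem false B) & contains x (B ++ B)]).
Proof.
rewrite -avoidsP; have tP := toeplitz_pointP false; have [fixt _ _] := tP.
rewrite /toeplitz_set closure_ptwsP; split=> [xt|xav N].
  apply: avoids_agree => N; have [_ [m _ <-] mx] := xt N.
  by exists (shiftz m (toeplitz_point false)) => //;
    apply/avoids_shiftz/avoids_taubar2_fixed.
have [m mx] := avoids_factor_toeplitz N xav tP.
by exists (shiftz m (toeplitz_point false)) => //; exists m.
Qed.
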